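(* Let $R$ be a ring and let $n\geq 2$ be an integer. The map $\Psi$ is a one-to-one correspondence (bijection) $$\Psi\colon\mathrm{SL}_2(R)\backslash\{\text{semiclosed paths of length }n\text{ in }\mathscr{E}_R\}\longrightarrow\{\text{tame regular friezes over }R\text{ of width }n\}.$$
   Context: All rings are commutative with identity $1$. A pair $(a,b)\in R\times R$ is unimodular if $aR+bR=R$. $\mathscr{E}_R$ is the directed graph whose vertices are the unimodular pairs in $R\times R$, with a directed edge $(a,b)\to(c,d)$ if and only if $ad-bc=1$. A path of length $n$ in $\mathscr{E}_R$ is a sequence of vertices $\langle v_0,\dots,v_n\rangle$ with $v_{i-1}\to v_i$ a directed edge for $i=1,\dots,n$; it is semiclosed if $v_n=-v_0$. $\mathrm{SL}_2(R)$ acts on vertices of $\mathscr{E}_R$ (regarded as column vectors) by left multiplication, and hence on paths. A frieze of width $n$ over $R$ is a function $\mathbf{F}\colon\{(i,j)\in\mathbb{Z}^2:0\leq i-j\leq n\}\to R$, $m_{i,j}=\mathbf{F}(i,j)$, with $m_{i,i}=m_{n+i,i}=0$ for all $i\in\mathbb{Z}$ and $m_{i,j}m_{i+1,j+1}-m_{i,j+1}m_{i+1,j}=1$ for $0<i-j<n$. It is tame if the 3-by-3 matrix with rows $i-1,i,i+1$ and columns $j-1,j,j+1$ of entries of $\mathbf{F}$ has determinant $0$ whenever $1<i-j<n-1$. It is regular if $m_{i+1,i}=m_{n+i-1,i}=1$ for all $i\in\mathbb{Z}$. The map $\Psi$ is defined as follows. Given a semiclosed path $\langle v_0,\dots,v_n\rangle$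 in $\mathscr{E}_R$, extend it to a bi-infinite path by $v_{i+n}=-v_i$ for $i\in\mathbb{Z}$, and write $v_i=(a_i,b_i)$. Then $\Psi$ sends the $\mathrm{SL}_2(R)$-orbit of the path to the frieze with entries $m_{i,j}=a_jb_i-b_ja_i$, $0\leq i-j\leq n$ (this is well defined). *)

(* Defs.v *)
From mathcomp Require Import all_boot all_order all_algebra.
From mathcomp Require Import all_classical.
From mathcomp Require Import ring.

Set Implicit Arguments.
Unset Strict Implicit.
Unset Printing Implicit Defensive.

Import Order.TTheory GRing.Theory Num.Theory.
Local Open Scope classical_set_scope.
Local Open Scope ring_scope.
Local Open Scope quotient_scope.

(* [comPzRingType] is the class of commutative rings with identity, the zero
   ring included. A pair (a, b) is represented as the column vector v with
   v 0 0 = a and v 1 0 = b. *)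

Definition unimodular (R : comPzRingType) (v : 'cV[R]_2) : Prop :=
  forall r : R, exists x y : R, v 0 0 * x + v 1 0 * y = r.

Definition edge (R : comPzRingType) (v w : 'cV[R]_2) : Prop :=
  v 0 0 * w 1 0 - v 1 0 * w 0 0 = 1.

Definition is_path (R : comPzRingType) (n : nat)
    (v : {ffun 'I_n.+1 -> 'cV[R]_2}) : Prop :=
  (forall i, unimodular (v i)) /\
  (forall i : 'I_n, edge (v (inord i)) (v (inord i.+1))).

Definition semiclosed (R : comPzRingType) (n : nat)
    (v : {ffun 'I_n.+1 -> 'cV[R]_2}) : Prop :=
  v ord_max = - v ord0.

Definition semiclosed_path (R : comPzRingType) (n : nat) : Type :=
  [set v : {ffun 'I_n.+1 -> 'cV[R]_2} | is_path v /\ semiclosed v].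

Definition same_SL2_orbit (R : comPzRingType) (n : nat) :
    rel (semiclosed_path R n) :=
  fun p q => `[< exists g : 'M[R]_2,
    \det g = 1 /\ forall i, val q i = g *m val p i >].

Lemma same_SL2_orbit_refl (R : comPzRingType) (n : nat) :
  reflexive (@same_SL2_orbit R n).
Proof.
move=> p; apply/asboolP; exists 1%:M.
by rewrite det1; split=> // i; rewrite mul1mx.
Qed.

Lemma same_SL2_orbit_sym (R : comPzRingType) (n : nat) :
  symmetric (@same_SL2_orbit R n).
Proof.
suff H p q : @same_SL2_orbit R n p q -> @same_SL2_orbit R n q p.
  by move=> p q; apply/idP/idP; exact: H.
move=> /asboolP[g [g1 pq]]; apply/asboolP; exists (\adj g); split.
  have := congr1 determinant (mul_mx_adj g).
  by rewrite det_mulmx g1 mul1r det1.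
by move=> i; rewrite pq mulmxA mul_adj_mx g1 mul1mx.
Qed.

Lemma same_SL2_orbit_trans (R : comPzRingType) (n : nat) :
  transitive (@same_SL2_orbit R n).
Proof.
move=> q p r /asboolP[g [g1 pq]] /asboolP[h [h1 qr]].
apply/asboolP; exists (h *m g); split; first by rewrite det_mulmx g1 h1 mulr1.
by move=> i; rewrite qr pq mulmxA.
Qed.

Canonical same_SL2_orbit_equiv (R : comPzRingType) (n : nat) :=
  EquivRel (@same_SL2_orbit R n) (@same_SL2_orbit_refl R n)
    (@same_SL2_orbit_sym R n) (@same_SL2_orbit_trans R n).

Definition path_orbit (R : comPzRingType) (n : nat) : Type :=
  {eq_quot (@same_SL2_orbit R n)}.

Definition frieze_dom (n : nat) : Type :=
  {ij : int * int | 0 <= ij.1 - ij.2 <= n%:Z}.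

(* The entry m_{i,j}; the value 0 outside the domain is never used by the
   predicates below. *)
Definition entry (R : comPzRingType) (n : nat) (F : frieze_dom n -> R)
    (i j : int) : R :=
  if insub (i, j) is Some x then F x else 0.

Definition frieze (R : comPzRingType) (n : nat) (F : frieze_dom n -> R) : Prop :=
  let m := entry F in
  (forall i : int, m i i = 0 /\ m (n%:Z + i) i = 0) /\
  (forall i j : int, 0 < i - j < n%:Z ->
    m i j * m (i + 1) (j + 1) - m i (j + 1) * m (i + 1) j = 1).

Definition tame (R : comPzRingType) (n : nat) (F : frieze_dom n -> R) : Prop :=
  forall i j : int, 1 < i - j < n%:Z - 1 ->
    \det (\matrix_(k < 3, l < 3) entry F (i - 1 + k%:Z) (j - 1 + l%:Z)) = 0.

Definition regular (R : comPzRingType) (n : nat) (F : frieze_dom n -> R) : Prop :=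
  let m := entry F in
  forall i : int, m (i + 1) i = 1 /\ m (n%:Z + i - 1) i = 1.

Definition tame_regular_friezes (R : comPzRingType) (n : nat) :
    set (frieze_dom n -> R) :=
  [set F | [/\ frieze F, tame F & regular F]].

(* The bi-infinite extension of v_0, ..., v_n by v_{i+n} = - v_i: writing
   i = q n + r with 0 <= r < n, one has v_i = (-1)^q v_r. *)
Definition extend (R : comPzRingType) (n : nat)
    (v : {ffun 'I_n.+1 -> 'cV[R]_2}) (i : int) : 'cV[R]_2 :=
  (-1) ^+ `|(i %/ n%:Z)%Z|%N *: v (inord `|(i %% n%:Z)%Z|%N).

Lemma extend_antiperiodic (R : comPzRingType) (n : nat)
    (v : {ffun 'I_n.+1 -> 'cV[R]_2}) (i : int) : (0 < n)%N ->
  extend v (i + n%:Z) = - extend v i.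
Proof.
move=> n0; have nz : n%:Z != 0 by rewrite eqz_nat -lt0n.
rewrite /extend modzDr divzDr ?dvdzz // divzz nz -scaleNr; congr (_ *: _).
have sE (z : int) : (-1) ^+ `|z|%N = (if odd `|z|%N then -1 else 1) :> R.
  by rewrite -signr_odd; case: odd; rewrite ?expr1 ?expr0.
rewrite !sE; case: (i %/ n%:Z)%Z => [k|[|k]] //=.
- by rewrite addn1 /=; case: odd; rewrite ?opprK.
- by rewrite opprK.
- by rewrite subn1 /=; case: odd; rewrite /= ?opprK.
Qed.

Lemma extend_ord (R : comPzRingType) (n : nat)
    (v : {ffun 'I_n.+1 -> 'cV[R]_2}) (i : 'I_n.+1) : (0 < n)%N ->
  semiclosed v -> extend v i%:Z = v i.
Proof.
move=> n0 sv; have [ltin|] := ltnP i n.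
  rewrite /extend divz_nat modz_nat divn_small // modn_small // expr0 scale1r.
  by rewrite absz_nat inord_val.
move=> leni; have -> : i = ord_max.
  by apply/val_inj/eqP; rewrite eqn_leq leni -ltnS ltn_ord.
rewrite sv -[X in Posz X]add0n PoszD extend_antiperiodic //.
rewrite /extend div0z mod0z expr0 scale1r; congr (- v _).
by apply/val_inj; rewrite /= inordK.
Qed.

Definition frieze_of_path (R : comPzRingType) (n : nat) (p : semiclosed_path R n) :
    frieze_dom n -> R :=
  fun x => let: (i, j) := val x in
    let v := extend (val p) in v j 0 0 * v i 1 0 - v j 1 0 * v i 0 0.

(* Defined on a chosen representative; [Psi_pi] shows that the choice is
   irrelevant. *)
Definition Psi (R : comPzRingType) (n : nat) (O : path_orbit R n) :
    frieze_dom n -> R :=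
  frieze_of_path (repr O).

Lemma frieze_of_path_orbit (R : comPzRingType) (n : nat)
    (p q : semiclosed_path R n) :
  same_SL2_orbit p q -> frieze_of_path p = frieze_of_path q.
Proof.
move=> /asboolP[g [g1 pq]]; apply/funext => -[[i j] ij].
rewrite /frieze_of_path /=.
have E k : extend (val q) k = g *m extend (val p) k.
  by rewrite /extend pq -scalemxAr.
rewrite !E; move: (extend _ i) (extend _ j) => vi vj.
have {}g1 : g 0 0 * g 1 1 - g 0 1 * g 1 0 = 1.
  rewrite -g1 (expand_det_row _ 0) !big_ord_recl big_ord0 /cofactor !det_mx11.
  rewrite !mxE /= expr0 expr1.
  have -> : lift 0 0 = 1 :> 'I_2 by apply/val_inj.
  have -> : lift 1 0 = 0 :> 'I_2 by apply/val_inj.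
  by ring.
rewrite !mxE !big_ord_recl !big_ord0 !addr0 /=.
have -> : lift ord0 ord0 = 1 :> 'I_2 by apply/val_inj.
have -> : ord0 = 0 :> 'I_2 by apply/val_inj.
move: g1; move: (g _ _) (g _ _) (g _ _) (g _ _) => a b c d g1.
rewrite -[LHS]mul1r -g1; ring.
Qed.

Lemma Psi_pi (R : comPzRingType) (n : nat) (p : semiclosed_path R n) :
  Psi (\pi_(path_orbit R n) p) = frieze_of_path p.
Proof.
by apply: frieze_of_path_orbit; apply/eqmodP; rewrite reprK.
Qed.

(* Main.v *)
Require Import Defs.
From mathcomp Require Import all_boot all_order all_algebra.
From mathcomp Require Import all_classical.
From mathcomp Require Import ring zify.

(** The entries of the frieze of a path are the determinants
    m_{i,j} = det(v_j, v_i). The frieze rule is then the Pluecker relation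
    between v_j, v_{j+1}, v_i, v_{i+1}; tameness holds because a matrix of such
    determinants factors through R^2, so that its 3-by-3 minors vanish; and
    regularity is the edge condition together with v_{i+n} = -v_i. This is
    [frieze_of_path_tame_regular].

    Since det(v_0, v_1) = 1, Cramer's rule ([det2_cramer]) gives
      v_k = - m_{k,1} v_0 + m_{k,0} v_1    for k = 1, ..., n.
    The coordinates of every v_k in the frame (v_0, v_1) are thus read off from
    the frieze. Two paths with the same frieze have the same coordinates in
    their first frames, and the matrix of determinant 1 carrying one frame to
    the other carries one path to the other ([frieze_of_path_inj]).

    The same coordinates give the inverse: from a tame regular frieze take the
    path v_0 = (1, 0), v_k = (- m_{k,1}, m_{k,0}). What must be seen is that the
    frieze of this path is the given one on the whole infinite strip, not just
    in the two columns used to define it. With a_i = m_{i+1,i-1}, tameness and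
    the frieze rule make consecutive rows obey
      m_{i+1,j} = a_i m_{i,j} - m_{i-1,j},
    with a coefficient independent of j ([frieze_row_rec]). No entry is ever
    divided by: the rule provides minors equal to 1, so the argument is valid
    over any commutative ring. The columns obey the analogous recurrence
    ([frieze_col_rec]), and comparing the two at the far boundary gives
    a_{i+n} = a_i ([quiddity_periodic]). Hence the antiperiodic extension of the
    path satisfies v_{i+1} = a_i v_i - v_{i-1} for all integers i
    ([extend_coords_rec]), and i |-> det(v_j, v_i) and i |-> m_{i,j} agree, since
    they solve the same recurrence with the initial values 0 and 1 at i = j and
    i = j + 1 ([frieze_of_path_surj]). *)

Set Implicit Arguments.
Unset Strict Implicit.
Unset Printing Implicit Defensive.

Import Order.TTheory GRing.Theory Num.Theory.
Local Open Scope classical_set_scope.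
Local Open Scope ring_scope.
Local Open Scope quotient_scope.

(** * Determinants of pairs of vectors *)

Definition det2 (R : comPzRingType) (v w : 'cV[R]_2) : R :=
  v 0 0 * w 1 0 - v 1 0 * w 0 0.

Lemma cV2P (R : comPzRingType) (v w : 'cV[R]_2) :
  v 0 0 = w 0 0 -> v 1 0 = w 1 0 -> v = w.
Proof.
move=> h0 h1; apply/matrixP => k l; rewrite (ord1 l).
case: k => [[|[|k]] hk] //; first by have -> : Ordinal hk = 0 by apply/val_inj.
by have -> : Ordinal hk = 1 by apply/val_inj.
Qed.

Lemma det2vv (R : comPzRingType) (v : 'cV[R]_2) : det2 v v = 0.
Proof. by rewrite /det2; ring. Qed.

Lemma det2_subZr (R : comPzRingType) (u v w : 'cV[R]_2) (a : R) :
  det2 u (a *: v - w) = a * det2 u v - det2 u w.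
Proof. by rewrite /det2 !mxE; ring. Qed.

Lemma det2Nr (R : comPzRingType) (v w : 'cV[R]_2) : det2 v (- w) = det2 w v.
Proof. by rewrite /det2 !mxE; ring. Qed.

Lemma det2_plucker (R : comPzRingType) (v v' w w' : 'cV[R]_2) :
  det2 v w * det2 v' w' - det2 v' w * det2 v w' = det2 v v' * det2 w w'.
Proof. by rewrite /det2; ring. Qed.

Lemma det2_cramer (R : comPzRingType) (v w u : 'cV[R]_2) : det2 v w = 1 ->
  u = - det2 w u *: v + det2 v u *: w.
Proof.
by move=> e; apply: cV2P; rewrite !mxE -[LHS]mul1r -{1}e /det2; ring.
Qed.

(** Entries are given by a function of natural numbers so that the indices
    produced by the cofactor expansion compute. *)
Lemma det_mx33 (R : comPzRingType) (f : nat -> nat -> R) :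
  \det (\matrix_(k < 3, l < 3) f k l) =
    f 0 0 * (f 1 1 * f 2 2 - f 1 2 * f 2 1)
  - f 0 1 * (f 1 0 * f 2 2 - f 1 2 * f 2 0)
  + f 0 2 * (f 1 0 * f 2 1 - f 1 1 * f 2 0).
Proof.
rewrite (expand_det_row _ ord0) !big_ord_recl big_ord0 /cofactor.
rewrite !(expand_det_row _ ord0) !big_ord_recl !big_ord0 /cofactor.
rewrite !det_mx11 !mxE /= /bump /= !(add0n, addn0, add1n).
by ring.
Qed.

Definition frame (R : comPzRingType) (v w : 'cV[R]_2) : 'M[R]_2 :=
  \matrix_(k, l) (if l == 0 then v else w) k 0.

Lemma det_frame (R : comPzRingType) (v w : 'cV[R]_2) :
  \det (frame v w) = det2 v w.
Proof.
rewrite (expand_det_row _ 0) !big_ord_recl big_ord0 /cofactor !det_mx11.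
rewrite !mxE /= /det2.
have -> : lift 0 0 = 1 :> 'I_2 by apply/val_inj.
by rewrite expr0 expr1; ring.
Qed.

Lemma frame_mul (R : comPzRingType) (v w u : 'cV[R]_2) :
  frame v w *m u = u 0 0 *: v + u 1 0 *: w.
Proof.
apply/matrixP => k l; rewrite (ord1 l) !mxE !big_ord_recl big_ord0 !mxE /=.
have -> : lift ord0 ord0 = 1 :> 'I_2 by apply/val_inj.
have -> : ord0 = 0 :> 'I_2 by apply/val_inj.
by ring.
Qed.

Lemma det_adj_SL2 (R : comPzRingType) (A : 'M[R]_2) :
  \det A = 1 -> \det (\adj A) = 1.
Proof.
move=> A1; have := congr1 determinant (mul_mx_adj A).
by rewrite det_mulmx A1 mul1r det1.
Qed.

(** * The bi-infinite extension of a path *)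

Lemma edge_unimodular (R : comPzRingType) (v w : 'cV[R]_2) :
  edge v w -> unimodular v /\ unimodular w.
Proof.
rewrite /edge => e; split=> r.
  by exists (r * w 1 0), (- r * w 0 0); rewrite -[RHS]mulr1 -e; ring.
by exists (- r * v 1 0), (r * v 0 0); rewrite -[RHS]mulr1 -e; ring.
Qed.

Lemma entryE (R : comPzRingType) (n : nat) (F : frieze_dom n -> R) x :
  F x = entry F (val x).1 (val x).2.
Proof. by rewrite /entry -surjective_pairing valK. Qed.

Lemma entry_frieze_of_path (R : comPzRingType) (n : nat)
    (p : semiclosed_path R n) (i j : int) : 0 <= i - j <= n%:Z ->
  entry (frieze_of_path p) i j = det2 (extend (val p) j) (extend (val p) i).
Proof. by move=> hij; rewrite /entry insubT. Qed.

(** Reduces statements about the extension of a path to the window of one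
    period in which it is given by the path itself. *)
Lemma int_periodic_ind (n : nat) (P : int -> Prop) : (0 < n)%N ->
  (forall i, P (i + n%:Z) <-> P i) ->
  forall c, (forall i, c <= i < c + n%:Z -> P i) -> forall i, P i.
Proof.
move=> n_gt0 per c hP i.
have shift (k : nat) j : P (j + n%:Z * k%:Z) <-> P j.
  elim: k => [|k IH]; first by rewrite mulr0 addr0.
  have -> : j + n%:Z * k.+1%:Z = j + n%:Z * k%:Z + n%:Z by lia.
  by rewrite per.
have r0 : 0 <= ((i - c) %% n%:Z)%Z by apply: modz_ge0; lia.
have rn : ((i - c) %% n%:Z)%Z < n%:Z by apply: ltz_pmod; lia.
have := divz_eq (i - c) n%:Z.
move: r0 rn; move: (_ %% _)%Z (_ %/ _)%Z => r q r0 rn E.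
have Pr : P (c + r) by apply: hP; lia.
case: q E => k E.
  have -> : i = (c + r) + n%:Z * k%:Z by lia.
  exact/shift.
apply/(shift k.+1); have -> // : i + n%:Z * k.+1%:Z = c + r.
by rewrite NegzE in E; nia.
Qed.

Lemma extend_nat (R : comPzRingType) (n : nat)
    (v : {ffun 'I_n.+1 -> 'cV[R]_2}) (k : nat) :
  (0 < n)%N -> semiclosed v -> (k <= n)%N -> extend v k%:Z = v (inord k).
Proof. by move=> n_gt0 sv kn; rewrite -extend_ord // inordK. Qed.

Lemma extend_edge (R : comPzRingType) (n : nat)
    (v : {ffun 'I_n.+1 -> 'cV[R]_2}) (i : int) :
  (0 < n)%N -> is_path v -> semiclosed v -> edge (extend v i) (extend v (i + 1)).
Proof.
move=> n_gt0 [_ pv] sv; move: i.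
apply: (int_periodic_ind n_gt0 _ (c := 0)) => [i|[k|k]] //.
  have -> : i + n%:Z + 1 = i + 1 + n%:Z by lia.
  by rewrite /edge !extend_antiperiodic // !mxE !mulrNN.
rewrite add0r => /andP[_ kn]; have {}kn : (k < n)%N by lia.
have -> : k%:Z + 1 = k.+1%:Z by lia.
by rewrite !extend_nat ?(ltnW kn) //; exact: (pv (Ordinal kn)).
Qed.

Lemma semiclosed_path_spec (R : comPzRingType) (n : nat)
    (p : semiclosed_path R n) :
  is_path (val p) /\ semiclosed (val p).
Proof. exact: set_mem (valP p). Qed.

(** * The frieze of a path is tame and regular *)

Lemma frieze_of_path_tame_regular (R : comPzRingType) (n : nat)
    (p : semiclosed_path R n) : (2 <= n)%N ->
  tame_regular_friezes (frieze_of_path p).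
Proof.
move=> hn; have n_gt0 : (0 < n)%N by lia.
have mE := entry_frieze_of_path p.
have [pp sp] := semiclosed_path_spec p.
have anti i := extend_antiperiodic (val p) i n_gt0.
have edge_p i : det2 (extend (val p) i) (extend (val p) (i + 1)) = 1.
  exact: extend_edge.
split.
- split=> [i|i j hij].
    rewrite !mE ?[n%:Z + i]addrC ?anti; try lia.
    by rewrite det2Nr det2vv.
  by rewrite !mE; [rewrite det2_plucker !edge_p mulr1|lia..].
- move=> i j hij.
  (* as a polynomial in the coordinates of the six vectors involved, the
     determinant is identically zero *)
  rewrite (det_mx33 (fun k l => entry _ (i - 1 + k%:Z) (j - 1 + l%:Z))).
  by rewrite !mE; [rewrite /det2; ring|lia..].
- move=> i; rewrite !mE; try lia.
  split; first exact: edge_p.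
  have -> : n%:Z + i - 1 = i - 1 + n%:Z by lia.
  by rewrite anti det2Nr -[X in det2 _ (extend _ X)](subrK 1) edge_p.
Qed.

(** * A path is determined by its frieze up to SL_2(R) *)

(** The coordinates (- m_{k,1}, m_{k,0}) of v_k in the frame (v_0, v_1). The
    value at k = 0 is separate because the formula would need the entry
    m_{0,1} = -1, which lies outside the strip. *)
Definition frame_coords (R : comPzRingType) (n : nat) (F : frieze_dom n -> R)
    (k : nat) : 'cV[R]_2 :=
  if k is 0 then delta_mx 0 0
  else \col_(l < 2) (if l == 0 then - entry F k%:Z 1 else entry F k%:Z 0).

Lemma path_in_frame (R : comPzRingType) (n : nat) (p : semiclosed_path R n)
    (i : 'I_n.+1) : (2 <= n)%N ->
  val p i = frame (extend (val p) 0) (extend (val p) 1)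
              *m frame_coords (frieze_of_path p) i.
Proof.
move=> hn; have n_gt0 : (0 < n)%N by lia.
have [pp sp] := semiclosed_path_spec p.
have e := extend_edge 0 n_gt0 pp sp; rewrite add0r in e.
rewrite -extend_ord // frame_mul.
case: i => [[|k] hk] /=; first by rewrite !mxE /= scale1r scale0r addr0.
rewrite !mxE /= !entry_frieze_of_path; try lia.
exact: det2_cramer.
Qed.

(** The two paths have the same coordinates in their frames P and Q of
    determinant 1, so Q P^-1 carries the first to the second. *)
Lemma frieze_of_path_inj (R : comPzRingType) (n : nat)
    (p q : semiclosed_path R n) : (2 <= n)%N ->
  frieze_of_path p = frieze_of_path q -> same_SL2_orbit p q.
Proof.
move=> hn Fpq; have n_gt0 : (0 < n)%N by lia.
have det_base (r : semiclosed_path R n) :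
    \det (frame (extend (val r) 0) (extend (val r) 1)) = 1.
  by have [pr sr] := semiclosed_path_spec r; rewrite det_frame;
    exact: (extend_edge 0).
pose P := frame (extend (val p) 0) (extend (val p) 1).
pose Q := frame (extend (val q) 0) (extend (val q) 1).
apply/asboolP; exists (Q *m \adj P).
split=> [|i].
  by rewrite det_mulmx [\det Q]det_base mul1r det_adj_SL2 ?det_base.
rewrite (path_in_frame p) // (path_in_frame q) // Fpq -/P -/Q.
by rewrite mulmxA -(mulmxA Q) mul_adj_mx det_base mulmx1.
Qed.

(** * Linear recurrences in a tame regular frieze *)

(** Let E_j be the defect of the relation in column j. It vanishes at j = i - 1
    by regularity and at j = i - 2 by the frieze rule. If it vanishes in columns
    j + 1 and j + 2, then the vanishing 3-by-3 determinant on rows i - 1, i,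
    i + 1 and columns j, j + 1, j + 2 equals E_j times the minor of rows i, i + 1
    and columns j + 1, j + 2, which is 1 by the frieze rule. *)
Lemma frieze_row_rec (R : comPzRingType) (n : nat) (F : frieze_dom n -> R)
    (i j : int) :
  tame_regular_friezes F -> i + 1 - n%:Z <= j <= i - 1 ->
  entry F (i + 1) j =
    entry F (i + 1) (i - 1) * entry F i j - entry F (i - 1) j.
Proof.
case=> [[F0 Fr] Ft F1]; set m := entry F in F0 Fr Ft F1 *.
pose E j := m (i + 1) j - (m (i + 1) (i - 1) * m i j - m (i - 1) j).
suff H (k : nat) : forall j : int,
    j = i - 1 - k%:Z -> i + 1 - n%:Z <= j -> E j = 0.
  move=> hj; apply: subr0_eq; rewrite -/(E j) (H `|(i - 1 - j)%R|%N) //; lia.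
have m1 (l : int) : m l (l - 1) = 1 by have [] := F1 (l - 1); rewrite subrK.
have E0 : E (i - 1) = 0 by rewrite /E m1 (F0 _).1; ring.
have E1 : i + 1 - n%:Z <= i - 1 - 1 -> E (i - 1 - 1) = 0.
  move=> hj; have := Fr i (i - 1 - 1).
  rewrite subrK m1 /E m1 => <-; last lia.
  ring.
elim/ltn_ind: k => -[|[|k]] IH {}j hj hjn.
- by have -> : j = i - 1 by lia.
- by have jE : j = i - 1 - 1 by []; rewrite jE E1 -?jE.
have Ej1 : E (j + 1) = 0 by apply: (IH k.+1); lia.
have Ej2 : E (j + 2) = 0 by apply: (IH k); lia.
have rule : m i (j + 1) * m (i + 1) (j + 2) - m i (j + 2) * m (i + 1) (j + 1) = 1.
  have := Fr i (j + 1).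
  have -> : j + 1 + 1 = j + 2 by lia.
  by apply; lia.
have := Ft i (j + 1).
rewrite (det_mx33 (fun k l => m (i - 1 + k%:Z) (j + 1 - 1 + l%:Z))).
have -> : i - 1 + 0%:Z = i - 1 by lia.
have -> : i - 1 + 1%:Z = i by lia.
have -> : i - 1 + 2%:Z = i + 1 by lia.
have -> : j + 1 - 1 + 0%:Z = j by lia.
have -> : j + 1 - 1 + 1%:Z = j + 1 by lia.
have -> : j + 1 - 1 + 2%:Z = j + 2 by lia.
move=> /(_ ltac:(lia)) det0.
(* expansion along the first row, after adding to it a combination of the
   other two that turns it into (E j, E (j + 1), E (j + 2)) *)
have -> : E j = E j * (m i (j + 1) * m (i + 1) (j + 2)
                       - m i (j + 2) * m (i + 1) (j + 1))
  - E (j + 1) * (m i j * m (i + 1) (j + 2) - m i (j + 2) * m (i + 1) j)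
  + E (j + 2) * (m i j * m (i + 1) (j + 1) - m i (j + 1) * m (i + 1) j).
  by rewrite rule Ej1 Ej2; ring.
rewrite -[RHS]det0 /E; ring.
Qed.

(** As functions of the row i, the columns j - 1, j and j + 1 solve the same
    second-order recurrence [frieze_row_rec], so a linear relation between them
    holds everywhere once it holds for i = j + 1 and i = j + 2. *)
Lemma frieze_col_rec (R : comPzRingType) (n : nat) (F : frieze_dom n -> R)
    (i j : int) :
  tame_regular_friezes F -> j + 1 <= i <= j - 1 + n%:Z ->
  entry F i (j + 1) =
    entry F (j + 1) (j - 1) * entry F i j - entry F i (j - 1).
Proof.
move=> FT hi; have rr a b := @frieze_row_rec R n F a b FT.
case: FT => [[F0 Fr] Ft F1]; set m := entry F in F0 Fr Ft F1 rr *.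
pose a (i : int) := m (i + 1) (i - 1).
suff H (k : nat) : forall i : int, i = j + 1 + k%:Z -> i <= j - 1 + n%:Z ->
    m i (j + 1) = a j * m i j - m i (j - 1).
  by apply: (H `|(i - (j + 1))%R|%N); lia.
have m1 (l : int) : m (l + 1) l = 1 by have [] := F1 l.
have m0 (l : int) : m l l = 0 by have [] := F0 l.
elim/ltn_ind: k => -[|[|k]] IH {hi}i hi hin.
- have -> : i = j + 1 by lia.
  by rewrite m0 m1 /a; ring.
- have iE : i = j + 1 + 1 by lia.
  rewrite {}iE {hi} in hin *.
  rewrite m1 [m _ (j - 1)]rr; last lia.
  have e := m1 (j - 1); rewrite subrK in e.
  by rewrite addrK e /a; ring.
have [l iE hl] : exists2 l, i = l + 1 & l = j + 1 + k.+1%:Z.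
  by exists (i - 1); lia.
rewrite {}iE {hi} in hin *.
rewrite [m (l + 1) (j + 1)]rr; last lia.
rewrite [m (l + 1) j]rr; last lia.
rewrite [m (l + 1) (j - 1)]rr; last lia.
rewrite (IH k.+1 _ l) // ?(IH k _ (l - 1)) //; try lia.
by ring.
Qed.

(** Near the far boundary of the strip the entries 1, 0 force both a_i (by the
    column recurrence) and a_{i+n} (by the row recurrence) to be the entry
    m_{i+n-1,i+1}. *)
Lemma quiddity_periodic (R : comPzRingType) (n : nat) (F : frieze_dom n -> R)
    (i : int) : (2 <= n)%N -> tame_regular_friezes F ->
  entry F (i + n%:Z + 1) (i + n%:Z - 1) = entry F (i + 1) (i - 1).
Proof.
move=> hn FT; have [[F0 _] _ F1] := FT.
have c : entry F (i + n%:Z - 1) (i + 1) = entry F (i + 1) (i - 1).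
  rewrite frieze_col_rec //; last lia.
  have -> : i + n%:Z - 1 = n%:Z + i - 1 by lia.
  rewrite (F1 i).2 -addrA (F0 (i - 1)).2; ring.
have := @frieze_row_rec R n F (i + n%:Z) (i + 1) FT.
have -> : i + n%:Z + 1 = n%:Z + (i + 1) by lia.
rewrite (F0 (i + 1)).2 c => r.
have e : entry F (i + n%:Z) (i + 1) = 1.
  by rewrite -(F1 (i + 1)).2; congr entry; lia.
by apply/subr0_eq; rewrite r ?e ?mulr1 //; lia.
Qed.

(** * Every tame regular frieze comes from a path *)

Lemma frame_coords_last (R : comPzRingType) (n : nat) (F : frieze_dom n -> R) :
  (2 <= n)%N -> tame_regular_friezes F -> frame_coords F n = - frame_coords F 0.
Proof.
case: n F => // n F hn [[F0 _] _ F1]; apply: cV2P; rewrite !mxE /= ?oppr0.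
  by rewrite -(F1 1).2; congr (- entry F _ _); lia.
by rewrite -(F0 0).2; congr entry; lia.
Qed.

Lemma frame_coords_edge (R : comPzRingType) (n : nat) (F : frieze_dom n -> R)
    (k : nat) :
  (k < n)%N -> tame_regular_friezes F ->
  edge (frame_coords F k) (frame_coords F k.+1).
Proof.
move=> kn [[F0 Fr] _ F1]; case: k kn => [|k] kn; rewrite /edge !mxE /=.
  by have [e _] := F1 0; rewrite add0r in e; rewrite e; ring.
have := Fr k.+1%:Z 0; rewrite add0r.
have -> : k.+1%:Z + 1 = k.+2%:Z by lia.
by move=> <-; [ring|lia].
Qed.

Lemma frame_coords_rec (R : comPzRingType) (n : nat) (F : frieze_dom n -> R)
    (k : nat) :
  (k.+1 < n)%N -> tame_regular_friezes F ->
  frame_coords F k.+2 = entry F k.+2%:Z k%:Z *: frame_coords F k.+1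
                       - frame_coords F k.
Proof.
move=> kn FT; have [[F0 _] _ F1] := FT.
have rr j := @frieze_row_rec R n F k.+1%:Z j FT.
have E1 : k.+1%:Z + 1 = k.+2%:Z by lia.
have E2 : k.+1%:Z - 1 = k%:Z by lia.
rewrite E1 E2 in rr.
case: k kn rr {E1 E2} => [|k] kn rr; apply: cV2P; rewrite !mxE /=.
- by rewrite (F0 1).1 (F1 1).1; ring.
- by have [e _] := F1 0; rewrite add0r in e; rewrite e; ring.
- by rewrite rr; [ring|lia].
- by rewrite rr; [ring|lia].
Qed.

(** By antiperiodicity of the extension and periodicity of the coefficients it
    suffices to treat i = 1, ..., n. For i < n this is the row recurrence in
    columns 0 and 1; the case i = n, where v_{n+1} = - v_1, links one period to
    the next. *)
Lemma extend_coords_rec (R : comPzRingType) (n : nat) (F : frieze_dom n -> R)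
    (v : {ffun 'I_n.+1 -> 'cV[R]_2}) (i : int) :
  (2 <= n)%N -> tame_regular_friezes F -> semiclosed v ->
  (forall k : 'I_n.+1, v k = frame_coords F k) ->
  extend v (i + 1) =
    entry F (i + 1) (i - 1) *: extend v i - extend v (i - 1).
Proof.
move=> hn FT sv vE; have n_gt0 : (0 < n)%N by lia.
have wE (k : nat) : (k <= n)%N -> extend v k%:Z = frame_coords F k.
  by move=> kn; rewrite extend_nat // vE inordK.
have anti j := extend_antiperiodic v j n_gt0.
move: i; apply: (int_periodic_ind n_gt0 _ (c := 1)) => [i|[[|k]|k] // hk].
  rewrite quiddity_periodic // ![i + n%:Z + _]addrAC !anti scalerN -opprD.
  by split=> [/oppr_inj|->].
have -> : k.+1%:Z + 1 = k.+2%:Z by lia.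
have -> : k.+1%:Z - 1 = k%:Z by lia.
have [kn|nk] := ltnP k.+1 n; first by rewrite !wE ?frame_coords_rec //; lia.
have {nk}nE : n = k.+1 by lia.
(* i = n; the hypothesis 2 <= n leaves n = k + 2 *)
subst n; case: k => // k in hn F FT v sv vE n_gt0 wE anti hk *.
have -> : k.+3%:Z = 1 + k.+2%:Z by lia.
rewrite anti (wE 1) // !wE // frame_coords_last //.
have [[F0 _] _ F1] := FT.
have := @frieze_row_rec R _ F k.+2%:Z 1 FT.
have -> : k.+2%:Z + 1 = 1 + k.+2%:Z by lia.
have -> : k.+2%:Z - 1 = k.+1%:Z by lia.
have -> : entry F (1 + k.+2%:Z) 1 = 0 by rewrite addrC (F0 1).2.
have -> : entry F k.+2%:Z 1 = 1.
  by rewrite -(F1 1).2; congr entry; lia.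
have e0 : entry F k.+1%:Z 0 = 1.
  by rewrite -(F1 0).2; congr entry; lia.
have e1 : entry F 1 0 = 1 by have [] := F1 0; rewrite add0r.
move=> /(_ ltac:(lia)) /esym/subr0_eq; rewrite mulr1 => ->.
by apply: cV2P; rewrite !mxE /= ?e0 ?e1 ?(F0 1).1; ring.
Qed.

Lemma frieze_of_path_surj (R : comPzRingType) (n : nat) (F : frieze_dom n -> R) :
  (2 <= n)%N -> tame_regular_friezes F ->
  exists p : semiclosed_path R n, frieze_of_path p = F.
Proof.
move=> hn FT; have n_gt0 : (0 < n)%N by lia.
pose v := [ffun k : 'I_n.+1 => frame_coords F k].
have vE k : v k = frame_coords F k by rewrite ffunE.
have sv : semiclosed v by rewrite /semiclosed !vE frame_coords_last.
have ev (k : 'I_n) : edge (v (inord k)) (v (inord k.+1)).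
  by have kn := ltn_ord k; rewrite !vE !inordK; [exact: frame_coords_edge|lia..].
have pv : is_path v.
  split=> // k; have [kn|nk] := ltnP k n.
    have := ev (Ordinal kn); rewrite /= inord_val.
    by case/edge_unimodular.
  have k0 : (0 < k)%N by apply: leq_trans nk.
  have kn : (k.-1 < n)%N by rewrite prednK // -ltnS.
  have := ev (Ordinal kn); rewrite /= prednK // inord_val.
  by case/edge_unimodular.
have pS : v \in [set v | is_path v /\ semiclosed v] by apply/mem_set.
exists (Sub v pS).
have [[F0 _] _ F1] := FT.
suff H (k : nat) : forall i j : int, i = j + k%:Z -> (k <= n)%N ->
    det2 (extend v j) (extend v i) = entry F i j.
  apply/funext => x; rewrite [RHS]entryE [LHS]entryE.
  case: x => [[i j] /= hij]; rewrite entry_frieze_of_path // SubK.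
  by apply: (H `|(i - j)%R|%N); lia.
elim/ltn_ind: k => -[|[|k]] IH i j iE kn.
- by rewrite iE addr0 det2vv (F0 j).1.
- by rewrite iE (F1 j).1; exact: extend_edge.
have [l {}iE lE] : exists2 l, i = l + 1 & l = j + k.+1%:Z.
  by exists (i - 1); lia.
rewrite {}iE (extend_coords_rec l hn FT sv vE) det2_subZr.
rewrite (IH k.+1 _ l) ?(IH k _ (l - 1)) //; try lia.
by rewrite [RHS]frieze_row_rec //; lia.
Qed.

Theorem theorem1p3 (R : comPzRingType) (n : nat) (hn : (2 <= n)%N) :
  set_bij [set: path_orbit R n] (@tame_regular_friezes R n) (@Psi R n).
Proof.
split.
- by move=> O _; exact: frieze_of_path_tame_regular.
- move=> O O' _ _ eqF; rewrite -[O]reprK -[O']reprK.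
  by apply/eqmodP; exact: frieze_of_path_inj.
- move=> F /(frieze_of_path_surj hn)[p pF].
  by exists (\pi_(path_orbit R n) p) => //; rewrite Psi_pi.
Qed.
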